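(* Let $\mathrm{Rec}$ be the model over $\mathbb N$ consisting of all total recursive functions $\mathbb N\to\mathbb N$. Then $\mathrm{Rec}$ is complete: for every model $M$ over $\mathbb N$ with $M\supseteq\mathrm{Rec}$ and $\mathrm{Rec}\succsim M$, we have $M=\mathrm{Rec}$. In particular, there is no hypercomputational model $M$ with $\mathrm{Rec}\succsim M$.
   Context: A model of computation over a set $D$ is any set of functions $f:D\to D\cup\{\bot\}$, where $\bot$ denotes ''undefined''. An encoding is an injection $\rho:\mathrm{dom}\,B\to\mathrm{dom}\,A$, extended by $\rho(\bot)=\bot$. Model $A$ simulates model $B$ via $\rho$, written $A\succsim_\rho B$, if for every $g\in B$ there is $f\in A$ with $\rho\circ g=f\circ\rho$. $A\succsim B$ means $A\succsim_\rho B$ for some injection $\rho$. For an injection $\rho:E\to D$ and a model $M$ over $D$, $\rho^{-1}\circ M\circ\rho$ denotes the set of all functions $g:E\to E\cup\{\bot\}$ such that $\rho\circ g=f\circ\rho$ for some $f\in M$. A model $M$ is hypercomputational if there is an injection $\rho:\mathbb N\to\mathrm{dom}\,M$ such that $\rho^{-1}\circ M\circ\rho\supsetneq\mathrm{Rec}$. *)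

(* Defs.v *)
From mathcomp Require Import all_boot.
From mathcomp Require Import boolp classical_sets.

Set Implicit Arguments.
Unset Strict Implicit.
Unset Printing Implicit Defensive.

Local Open Scope classical_set_scope.

(** * Models of computation *)

(* [None] plays the role of the undefined value. *)
Definition model (D : Type) := set (D -> option D).

(* [omap rho] is the extension of [rho] by [rho None = None]. *)
Definition simulates_via (D E : Type) (A : model D) (rho : E -> D)
    (B : model E) : Prop :=
  forall g, B g -> exists2 f, A f & omap rho \o g = f \o rho.

Definition simulates (D E : Type) (A : model D) (B : model E) : Prop :=
  exists2 rho : E -> D, injective rho & simulates_via A rho B.

(* The model written rho^-1 o M o rho. *)
Definition pullback_model (D E : Type) (rho : E -> D) (M : model D) : model E :=
  [set g | exists2 f, M f & omap rho \o g = f \o rho].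

Definition complete_model (D : Type) (A : model D) : Prop :=
  forall M : model D, A `<=` M -> simulates A M -> M = A.

(** * Recursive functions *)

Inductive murec : nat -> Type :=
| MuZero k : murec k
| MuSucc : murec 1
| MuProj k (i : 'I_k) : murec k
| MuComp k m (f : murec m) (g : 'I_m -> murec k) : murec k
| MuPrim k (f : murec k) (g : murec k.+2) : murec k.+1
| MuMin k (f : murec k.+1) : murec k.

(* Graph of the partial function h given by h(0, v) = F(v) and
   h(n + 1, v) = G(n, h(n, v), v). *)
Fixpoint prim_graph k (F : k.-tuple nat -> nat -> Prop)
    (G : k.+2.-tuple nat -> nat -> Prop) (n : nat) (v : k.-tuple nat)
    (y : nat) : Prop :=
  match n with
  | 0 => F v y
  | n'.+1 => exists2 z, prim_graph F G n' v z & G [tuple of n' :: z :: v] y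
  end.

(* [mu_graph c v y]: the partial function denoted by [c] is defined at [v], with
   value [y]. *)
Fixpoint mu_graph k (c : murec k) : k.-tuple nat -> nat -> Prop :=
  match c in murec k return k.-tuple nat -> nat -> Prop with
  | MuZero _ => fun _ y => y = 0
  | MuSucc => fun v y => y = (thead v).+1
  | MuProj _ i => fun v y => y = tnth v i
  | MuComp _ m f g => fun v y =>
      exists2 w : m.-tuple nat,
        forall i, mu_graph (g i) v (tnth w i) & mu_graph f w y
  | MuPrim _ f g => fun v y =>
      prim_graph (mu_graph f) (mu_graph g) (thead v) [tuple of behead v] y
  | MuMin _ f => fun v y =>
      mu_graph f [tuple of y :: v] 0 /\
      forall z, z < y -> exists u, mu_graph f [tuple of z :: v] u.+1
  end.

Definition total_recursive (h : nat -> nat) : Prop :=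
  exists c : murec 1, forall n y, mu_graph c [tuple n] y <-> h n = y.

Definition Rec : model nat :=
  [set (fun n => Some (h n)) | h in total_recursive].

Definition hypercomputational (D : Type) (M : model D) : Prop :=
  exists2 rho : nat -> D, injective rho & Rec `<` pullback_model rho M.

(* Main.v *)
Require Import Defs.
From mathcomp Require Import all_boot.
From mathcomp Require Import boolp classical_sets.

(** Let [rho] encode a model containing [Rec] into [Rec].  The successor is
    simulated by a recursive [s], so [rho n.+1 = s (rho n)] and [rho] itself is
    recursive by primitive recursion.  If [f] recursive simulates [g], then
    [g n] is the least [m] with [rho m = f (rho n)], so [g] is total recursive.
    A hypercomputational model simulated by [Rec] would pull back to a model
    over [nat] strictly extending [Rec] and still simulated by [Rec]. *)

Set Implicit Arguments.
Unset Strict Implicit.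
Unset Printing Implicit Defensive.

Local Open Scope classical_set_scope.

(** The [k]-ary form of [total_recursive], since recursion and minimization change the arity. The
    equivalence makes the graph of the code total and single-valued at once. *)
Definition recursive k (F : k.-tuple nat -> nat) : Prop :=
  exists c : murec k, forall v y, mu_graph c v y <-> F v = y.

Lemma recursive_proj k (i : 'I_k) : recursive (fun v => tnth v i).
Proof. by exists (MuProj i) => v y; split => /= ->. Qed.

Lemma recursive_comp k m (F : m.-tuple nat -> nat)
    (G : 'I_m -> k.-tuple nat -> nat) :
  recursive F -> (forall i, recursive (G i)) ->
  recursive (fun v => F [tuple G i v | i < m]).
Proof.
move=> [f fP] /choice[g gP]; exists (MuComp f g) => v y /=; split.
- move=> [w wP /fP <-]; congr F; apply: eq_from_tnth => i.
  by rewrite tnth_mktuple; apply/gP.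
- move=> Fy; exists [tuple G i v | i < m]; last exact/fP.
  by move=> i; rewrite tnth_mktuple; apply/gP.
Qed.

Lemma recursive_prim k (F : k.-tuple nat -> nat) (G : k.+2.-tuple nat -> nat)
    (H : nat -> k.-tuple nat -> nat) :
  recursive F -> recursive G ->
  (forall v, H 0 v = F v) ->
  (forall n v, H n.+1 v = G [tuple of n :: H n v :: v]) ->
  recursive (fun v : k.+1.-tuple nat => H (thead v) [tuple of behead v]).
Proof.
move=> [f fP] [g gP] H0 HS; exists (MuPrim f g) => v y /=.
elim: (thead v) y => [|n IHn] y /=; first by rewrite H0.
rewrite HS; split; first by move=> [z /IHn <- /gP].
by move=> Gy; exists (H n [tuple of behead v]); [exact/IHn | exact/gP].
Qed.

(** The hypotheses make [H v] the least zero of [F] in its first argument, and totality of [F] keeps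
    the search defined up to that zero. *)
Lemma recursive_min k (F : k.+1.-tuple nat -> nat) (H : k.-tuple nat -> nat) :
  recursive F -> (forall v, F [tuple of H v :: v] = 0) ->
  (forall v z, z < H v -> F [tuple of z :: v] <> 0) ->
  recursive H.
Proof.
move=> [f fP] FH0 FHN; exists (MuMin f) => v y /=; split; last first.
  move=> <-; split; first exact/fP.
  move=> z /FHN; case Fz: (F _) => [//|u] _.
  by exists u; exact/fP.
(* If [H v < y], then [ylt] makes [F] positive at [H v], against [FH0]; if [y < H v], then [FHN]
   contradicts [Fy]. *)
move=> [/fP Fy ylt]; case: (ltngtP (H v) y) => // [/ylt[u /fP]|/FHN //].
by rewrite FH0.
Qed.

Lemma total_recursiveP (h : nat -> nat) :
  total_recursive h <-> recursive (fun v : 1.-tuple nat => h (thead v)).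
Proof.
split=> -[c cP]; exists c; last by move=> n; exact: (cP [tuple n]).
by move=> v y; case/tupleP: v => n v; rewrite (tuple0 v); exact: cP.
Qed.

Lemma recursive_comp1 (h : nat -> nat) k (G : k.-tuple nat -> nat) :
  total_recursive h -> recursive G -> recursive (fun v => h (G v)).
Proof.
move=> /total_recursiveP hrec Grec.
have := recursive_comp hrec (fun _ => Grec); congr recursive.
by apply/funext => v; rewrite /thead tnth_mktuple.
Qed.

Lemma recursive_comp2 (h : nat -> nat -> nat) k (G1 G2 : k.-tuple nat -> nat) :
  recursive (fun v : 2.-tuple nat => h (tnth v ord0) (tnth v ord_max)) ->
  recursive G1 -> recursive G2 -> recursive (fun v => h (G1 v) (G2 v)).
Proof.
move=> hrec G1rec G2rec.
pose G (i : 'I_2) := if i == ord0 then G1 else G2.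
have Grec i : recursive (G i) by rewrite /G; case: ifP.
have := recursive_comp hrec Grec; congr recursive.
by apply/funext => v; rewrite !tnth_mktuple.
Qed.

Lemma total_recursiveS : total_recursive succn.
Proof. by exists MuSucc => n y; split => /= ->. Qed.

Lemma recursive_const k a : recursive (fun _ : k.-tuple nat => a).
Proof.
elim: a => [|a IHa]; first by exists (MuZero k) => v y; split => /= ->.
exact: (recursive_comp1 total_recursiveS IHa).
Qed.

(** Meant for an encoding [r] with [r n.+1 = s (r n)], which is [iter n s (r 0)]. *)
Lemma total_recursive_iter (s : nat -> nat) a :
  total_recursive s -> total_recursive (fun n => iter n s a).
Proof.
move=> srec; apply/total_recursiveP.
(* Without parameters the step function receives the counter and the previous value; [ord_max]
   selects the latter. *)
apply: (@recursive_prim 0 (fun _ => a) (fun v => s (tnth v ord_max))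
          (fun n _ => iter n s a)) => //; first exact: recursive_const.
exact: (recursive_comp1 srec (recursive_proj _)).
Qed.

Lemma total_recursive_pred : total_recursive predn.
Proof.
apply/total_recursiveP.
apply: (@recursive_prim 0 (fun _ => 0) (fun v => tnth v ord0)
          (fun n _ => n.-1)) => //; first exact: recursive_const.
exact: recursive_proj.
Qed.

Lemma recursive_iter2 (s : nat -> nat) :
  total_recursive s ->
  recursive (fun v : 2.-tuple nat => iter (tnth v ord0) s (tnth v ord_max)).
Proof.
move=> srec.
have := @recursive_prim 1 (fun v => tnth v ord0)
          (fun v => s (tnth v (lift ord0 ord0)))
          (fun n v => iter n s (tnth v ord0))
          (recursive_proj _) (recursive_comp1 srec (recursive_proj _)).
move=> /(_ (fun=> erefl) (fun _ _ => erefl)); congr recursive.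
(* The parameter is read off at index [inord 1], to be identified with [ord_max]. *)
apply/funext => v; rewrite tnth_behead; congr (iter _ s (tnth v _)).
by apply: val_inj; rewrite /= inordK.
Qed.

Lemma recursive_add k (G1 G2 : k.-tuple nat -> nat) :
  recursive G1 -> recursive G2 -> recursive (fun v => G1 v + G2 v).
Proof.
move=> G1rec G2rec.
have := recursive_comp2 (h := fun n x => iter n succn x)
  (recursive_iter2 total_recursiveS) G1rec G2rec.
by congr recursive; apply/funext => v; rewrite iter_succn addnC.
Qed.

Lemma recursive_sub k (G1 G2 : k.-tuple nat -> nat) :
  recursive G1 -> recursive G2 -> recursive (fun v => G1 v - G2 v).
Proof.
move=> G1rec G2rec.
(* Truncated subtraction iterates the predecessor; the subtrahend counts the iterations, so [G2]
   comes first. *)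
have := recursive_comp2 (h := fun n x => iter n predn x)
  (recursive_iter2 total_recursive_pred) G2rec G1rec.
congr recursive; apply/funext => v.
by elim: (G2 v) => [|n IHn]; rewrite ?subn0 // subnS -IHn.
Qed.

(** Injectivity of [r] makes [h n] the only [z] with [r z = f (r n)], so an unbounded search for
    equality of both sides stops exactly there. *)
Lemma total_recursive_lift (r f h : nat -> nat) :
  injective r -> total_recursive r -> total_recursive f ->
  (forall n, r (h n) = f (r n)) -> total_recursive h.
Proof.
move=> r_inj rrec frec rh; apply/total_recursiveP.
pose A (v : 2.-tuple nat) := r (tnth v ord0).
pose B (v : 2.-tuple nat) := f (r (tnth v ord_max)).
have Arec : recursive A := recursive_comp1 rrec (recursive_proj _).
have Brec : recursive B.
  exact: (recursive_comp1 frec (recursive_comp1 rrec (recursive_proj _))).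
have AE z (v : 1.-tuple nat) : A [tuple of z :: v] = r z by [].
have BE z (v : 1.-tuple nat) : B [tuple of z :: v] = r (h (thead v)).
  by case/tupleP: v => n v; rewrite /B rh.
(* The distance |A - B|, in truncated subtraction. *)
apply: (@recursive_min 1 (fun v => (A v - B v) + (B v - A v))).
- exact: recursive_add (recursive_sub Arec Brec) (recursive_sub Brec Arec).
- by move=> v; rewrite AE BE subnn.
- move=> v z zlt /eqP; rewrite AE BE addn_eq0 !subn_eq0 -eqn_leq.
  by move=> /eqP/r_inj zE; rewrite zE ltnn in zlt.
Qed.

Lemma complete_Rec : complete_model Rec.
Proof.
move=> M RecM [r r_inj simM]; apply/seteqP; split => // g Mg.
have rrec : total_recursive r.
  have RecS : Rec (fun n => Some n.+1) by exists succn => //; exact: total_recursiveS.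
  have [_ [s srec <-] rS] := simM _ (RecM _ RecS).
  have := total_recursive_iter (r 0) srec; congr total_recursive.
  apply/funext; elim=> //= n ->.
  by have /(congr1 (@^~ n)) [] := rS.
have [_ [f frec <-] gf] := simM _ Mg.
have gfE n : omap r (g n) = Some (f (r n)) := congr1 (@^~ n) gf.
(* A simulating function in [Rec] is total, so [g n] cannot be [None] and the default [0] is never
   taken. *)
have gE n : g n = Some (odflt 0 (g n)) by have := gfE n; case: (g n).
exists (fun n => odflt 0 (g n)); last by apply/funext => n; rewrite -gE.
apply: (total_recursive_lift r_inj rrec frec) => n.
by have := gfE n; rewrite gE => -[].
Qed.

(** Encodings compose: if [f] witnesses that [g] is in the pullback, the function of [K] simulating
    [f] via [sigma] also simulates [g] via [sigma \o rho]. *)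
Lemma simulates_pullback (A D E : Type) (K : model A) (M : model D)
    (rho : E -> D) :
  injective rho -> simulates K M -> simulates K (pullback_model rho M).
Proof.
move=> rho_inj [sigma sigma_inj simM].
exists (sigma \o rho); first exact: inj_comp.
move=> g [f /simM[h Kh hf] fg]; exists h => //; apply/funext => x /=.
have /(congr1 (omap sigma)) := congr1 (@^~ x) fg.
rewrite /= -/((omap sigma \o f) (rho x)) hf /= => <-.
by case: (g x).
Qed.

Theorem mainTheorem2 :
  complete_model Rec /\
  ~ (exists (D : Type) (M : model D), hypercomputational M /\ simulates Rec M).
Proof.
split; first exact: complete_Rec.
move=> [D [M [[rho rho_inj [RecP PRec]] simM]]]; apply: PRec.
(* Completeness identifies the pullback with [Rec], so the inclusion denied by strictness becomes
   reflexive. *)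
by rewrite (complete_Rec RecP (simulates_pullback rho_inj simM)).
Qed.
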